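(* Let $1\le c<n$ with $c\ge\lfloor n/2\rfloor$, let $1\le d\le\min\{n-c,\lfloor n/2\rfloor\}$, and let $\mathbf{s}_n\in\mathcal{B}(n,c,d)$ with $add(\mathbf{s}_n)=t$. Then: (i) for any $1\le k\le\min\{t,\,n-c-d\}$, $R^k(\mathbf{s}_n)\in\mathcal{B}(n,c+k,d)$ and $nlc(R^k(\mathbf{s}_n))=c+k$; (ii) for any $t<k\le n-c-d$, $nlc(R^k(\mathbf{s}_n))=c+t$.
   Context: All sequences are binary (over $\mathbb{Z}_2=\{0,1\}$). A finite sequence $\mathbf{s}_n=(s_0,\dots,s_{n-1})$ is aperiodic if it is not of the form $(s_0,\dots,s_{k-1})^{n/k}$ (concatenation of $n/k$ copies) for a proper divisor $k$ of $n$. Circular shifts: $L(\mathbf{s}_n)=(s_1,\dots,s_{n-1},s_0)$, $L^k$ its $k$-fold iterate, and $R^k=L^{n-k}$ (right circular shift by $k$). Nonlinear complexity: $nlc(\mathbf{s})$ of a finite sequence is the length of the shortest feedback shift register generating it, i.e. the least $m\ge 0$ such that there is a function $f:\mathbb{Z}_2^m\to\mathbb{Z}_2$ with $s_{i+m}=f(s_i,\dots,s_{i+m-1})$ for all $i\ge0$ for which $s_{i+m}$ is defined. For $1\le c<n$ and $1\le d\le\min\{n-c,\lfloor n/2\rfloor\}$, $\mathcal{B}(n,c,d)$ is the set of aperiodic binary sequences $\mathbf{s}_n$ such that $(s_0,\dots,s_{d-1})$ is aperiodic, $s_i=s_{i+d}$ for $0\le i\le c-2$, and $s_{c-1}\ne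 s_{c+d-1}$ (remaining terms arbitrary subject to $\mathbf{s}_n$ being aperiodic). For $\mathbf{s}_n\in\mathcal{B}(n,c,d)$, $add(\mathbf{s}_n)$ is the integer $t\ge0$ with $s_{n-1-i}=s_{(d-1-i)\bmod d}$ for $0\le i<t$ and $s_{n-1-t}\ne s_{(d-1-t)\bmod d}$. *)

(* Defs.v *)
From mathcomp Require Import all_boot ssralg zmodp.

Set Implicit Arguments.
Unset Strict Implicit.
Unset Printing Implicit Defensive.

Import GRing.Theory.

(* In what follows [s`_i] is only meaningful for [i < size s]; beyond the end
   it defaults to 0, and every use below stays in range. *)

(* The index [k] ranges over [0 <= k < size s]; [k = 0] does not divide the size
   of a nonempty sequence, so the test is over its proper divisors. *)
Definition aperiodic (s : seq 'Z_2) : bool :=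
  [forall k : 'I_(size s),
     (k %| size s) ==> (s != flatten (nseq (size s %/ k) (take k s)))].

(* The m-stage feedback shift register with feedback function [f] outputs [s]
   when started on the first m terms of [s]. *)
Definition fsr_generates (m : nat) (f : {ffun m.-tuple 'Z_2 -> 'Z_2})
    (s : seq 'Z_2) : bool :=
  [forall i : 'I_(size s),
     (i + m < size s) ==> ((s`_(i + m))%R == f [tuple (s`_(i + j))%R | j < m])].

Definition fsr_generable (s : seq 'Z_2) (m : nat) : bool :=
  [exists f : {ffun m.-tuple 'Z_2 -> 'Z_2}, fsr_generates f s].

Fact ex_fsr_generable (s : seq 'Z_2) : exists m, fsr_generable s m.
Proof.
exists (size s); apply/existsP; exists [ffun=> 0%R].
by apply/forallP => i; rewrite ltnNge leq_addl.
Qed.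

Definition nlc (s : seq 'Z_2) : nat := ex_minn (ex_fsr_generable s).

(* Meant for [1 <= c < n] and [1 <= d <= minn (n - c) n./2]. *)
Definition B (n c d : nat) : {set n.-tuple 'Z_2} :=
  [set s : n.-tuple 'Z_2 |
    [&& aperiodic s,
        aperiodic (take d s),
        [forall i : 'I_c.-1, (s`_i)%R == (s`_(i + d))%R]
      & (s`_(c - 1))%R != (s`_(c + d - 1))%R]].

(* The least [t < n] with s_{n-1-t} <> s_{(d-1-t) mod d}.  The natural number
   [d - 1 - i %% d] is the residue of the integer d-1-i modulo d (d > 0).
   Such a [t] exists as soon as [s \in B n c d] for admissible [c] and [d]:
   otherwise [s] would repeat its first [d] terms backwards from its end,
   contradicting s_{c-1} <> s_{c+d-1}. *)
Definition seq_add (n d : nat) (s : n.-tuple 'Z_2) : nat :=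
  find (fun i => (s`_(n - 1 - i))%R != (s`_(d - 1 - i %% d))%R) (iota 0 n).

(* Main.v *)
Require Import Defs.
From mathcomp Require Import all_boot ssralg zmodp.
From mathcomp Require Import zify.

(** [rotr k s] contains a maximal run of period [d] whose two ends are [k - u]
and [k + c + d - 1], where [u] is the minimum of [k] and [t]; it has length
[M + d - 1] with [M = c + u].  The run together with the letter breaking it on
the right gives two occurrences of a word of length [M - 1] with different
successors, so the complexity is at least [M].  If two occurrences at distance
[e] of a word of length [M] had different successors, they would span a
segment of period [e]; since [M] is at least the half (rounded down) of [n], this segment
meets the run in at least [d + e - 1] places, so by Fine and Wilf and the
aperiodicity of the period word [d] divides [e].  Then the whole segment has
period [d], so it extends the run or lies inside it, and both are impossible. *)

Set Implicit Arguments.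
Unset Strict Implicit.
Unset Printing Implicit Defensive.

(** * Periods of a function on an interval; the theorem of Fine and Wilf *)

Section PeriodicOn.

Variable T : Type.
Implicit Types (f : nat -> T) (p q g e d lo hi : nat).

(** Congruent pairs rather than neighbours at distance [p], so that points can be replaced by
    representatives modulo [p] inside the interval. *)
Definition periodic_on f p lo hi :=
  forall x y, lo <= x < hi -> lo <= y < hi -> x = y %[mod p] -> f x = f y.

Lemma periodic_on_step f p lo hi :
  (forall x, lo <= x -> x + p < hi -> f x = f (x + p)) -> periodic_on f p lo hi.
Proof.
move=> step.
have mul k x : lo <= x -> x + k * p < hi -> f x = f (x + k * p).
  elim: k => [|k IHk] lo_x lt_hi; first by rewrite addn0.
  have e : x + k.+1 * p = x + k * p + p by rewrite mulSn addnCA addnC.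
  by rewrite e -step ?IHk //; lia.
have le x y : lo <= x -> y < hi -> x <= y -> x = y %[mod p] -> f x = f y.
  move=> lo_x lt_hi le_xy /esym/eqP; rewrite eqn_mod_dvd // => /dvdnP[k ek].
  have -> : y = x + k * p by lia.
  by apply: mul; lia.
move=> x y /andP[lx xh] /andP[ly yh] exy.
by case: (leqP x y) => [|/ltnW] h; [apply: le | apply/esym/le].
Qed.

Lemma periodic_on_sub f p lo hi lo' hi' :
  lo <= lo' -> hi' <= hi -> periodic_on f p lo hi -> periodic_on f p lo' hi'.
Proof. by move=> l h per x y /andP[? ?] /andP[? ?]; apply: per; lia. Qed.

Lemma mod_representative p lo x :
  0 < p -> exists2 y, lo <= y < lo + p & y = x %[mod p].
Proof.
(* [p - lo %% p] acts as the negative of [lo] modulo [p]. *)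
move=> p0; exists (lo + (x + (p - lo %% p)) %% p).
  by rewrite leq_addr ltn_add2l ltn_mod.
rewrite modnDmr addnCA -modnDmr -(modnDml lo).
by rewrite subnKC ?modnn ?addn0 // ltnW // ltn_mod.
Qed.

(** Each point of the large interval moves by multiples of [p] into a window of [p] places of the
    small one, which keeps its class modulo [g]. *)
Lemma periodic_on_extend f p g lo hi lo' hi' :
  0 < p -> g %| p -> lo <= lo' -> hi' <= hi -> lo' + p <= hi' ->
  periodic_on f p lo hi -> periodic_on f g lo' hi' -> periodic_on f g lo hi.
Proof.
move=> p0 + l h len perp perg x y hx hy.
have inw z : lo' <= z < lo' + p -> lo' <= z < hi' by lia.
have inW z : lo' <= z < lo' + p -> lo <= z < hi by lia.
move=> gp exy; have [x' hx' ex] := mod_representative lo' x p0.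
have [y' hy' ey] := mod_representative lo' y p0.
rewrite -(perp x' x) -?(perp y' y) ?(inW x') ?(inW y') //.
apply: perg; rewrite ?inw //.
by rewrite -(modn_dvdm x' gp) ex modn_dvdm // exy -(modn_dvdm y' gp) ey modn_dvdm.
Qed.

(** Euclid by subtraction: [(p, q)] becomes [(p, q - p)] on the interval shortened by [p], so [hi]
    varies in the induction; the common period then extends back. *)
Theorem Fine_Wilf f p q lo hi :
  0 < p -> 0 < q -> lo + p + q <= hi + gcdn p q ->
  periodic_on f p lo hi -> periodic_on f q lo hi ->
  periodic_on f (gcdn p q) lo hi.
Proof.
elim: {p q}(p + q) {-2}p {-2}q (leqnn (p + q)) hi => [|N IH] p q leN hi p0 q0.
  by lia.
wlog lt_pq : p q leN p0 q0 / p <= q.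
  move=> W len perp perq; case: (leqP p q) => [|/ltnW] h; first exact: W.
  by rewrite gcdnC; apply: W => //; rewrite 1?gcdnC //; lia.
move=> len perp perq; move: lt_pq; rewrite leq_eqVlt => /predU1P[epq|lt_pq].
  by rewrite -epq gcdnn.
have eg : gcdn p (q - p) = gcdn p q by rewrite -{2}(subnK (ltnW lt_pq)) gcdnDr.
(* This bound leaves at least [p] places in the shortened interval, as the extension requires. *)
have gle : gcdn p q <= q - p by rewrite -eg dvdn_leq ?dvdn_gcdr // subn_gt0.
have perg : periodic_on f (gcdn p q) lo (hi - p).
  rewrite -eg; apply: IH; rewrite ?eg; try lia.
    by apply: periodic_on_sub perp => //; lia.
  apply: periodic_on_step => x lo_x lt_hi.
  rewrite (perq x (x + (q - p) + p)) ?(perp _ (x + (q - p) + p)) ?modnDr //;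
    try lia.
  by have -> : x + (q - p) + p = x + q; [lia | rewrite modnDr].
by apply: periodic_on_extend perp perg; rewrite ?dvdn_gcdl //; lia.
Qed.

End PeriodicOn.

(** * Repeated words against a maximal run *)

Section MaximalRun.

(* The run is the interval [a, a + M + d - 1); [k] is some place where its
   period word is known to be primitive. *)
Variables (T : Type) (r : nat -> T) (n d a M k : nat).
Hypotheses (d_gt0 : 0 < d) (M_gt0 : 0 < M).
Hypothesis run : periodic_on r d a (a + M + d - 1).
Hypotheses (ge_ak : a <= k) (le_k : k + d <= a + M + d - 1).
Hypothesis primitive_word :
  forall g, g %| d -> g < d -> ~ periodic_on r g k (k + d).

(** A smaller period dividing [d] would spread from [lo] over the whole run and so reach the word at
    [k]. *)
Lemma run_primitive g lo :
  a <= lo -> lo + d <= a + M + d - 1 -> g %| d -> g < d ->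
  ~ periodic_on r g lo (lo + d).
Proof.
move=> lo_a lo_b gd ltg perg; apply: (primitive_word gd ltg).
by apply: periodic_on_sub (periodic_on_extend _ gd lo_a lo_b _ run perg).
Qed.

Hypothesis run_right : r (a + M - 1) <> r (a + M + d - 1).
Hypothesis run_left : a = 0 \/ r (a - 1) <> r (a - 1 + d).
Hypotheses (len_n : a + M + d <= n) (n_le : n <= M.*2.+1) (d_leM : d <= M).

Lemma run_same_successor i e :
  0 < e -> i + e + M < n ->
  (forall x, x < M -> r (i + x) = r (i + e + x)) -> r (i + M) = r (i + e + M).
Proof.
move=> e0 lt_n eqw.
have pere : periodic_on r e i (i + e + M).
  apply: periodic_on_step => x lo_x lt_hi.
  have -> : x = i + (x - i) by lia.
  by rewrite eqw ?[i + (x - i) + e]addnAC //; lia.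
pose lo := maxn i a; pose hi := minn (i + e + M) (a + M + d - 1).
(* From [n <= M.*2.+1] come [i + e <= M] and [a + d <= M + 1], which make the overlap long enough
   even for gcd 1. *)
have len : lo + d + e <= hi + 1 by rewrite /lo /hi; lia.
have perd : periodic_on r d lo hi by apply: periodic_on_sub run; rewrite /lo /hi; lia.
have perg : periodic_on r (gcdn d e) lo hi.
  apply: Fine_Wilf => //.
    by have : 0 < gcdn d e; [rewrite gcdn_gt0 d_gt0 | lia].
  by apply: periodic_on_sub pere; rewrite /lo /hi; lia.
have d_e : d %| e.
  suff /eqP <- : gcdn d e == d by exact: dvdn_gcdr.
  rewrite eqn_leq dvdn_leq ?dvdn_gcdl //= leqNgt; apply/negP => ltg.
  apply: (@run_primitive (gcdn d e) lo); rewrite ?dvdn_gcdl //;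
    try by rewrite /lo /hi in len *; lia.
  by apply: periodic_on_sub perg => //; lia.
have lede := dvdn_leq e0 d_e.
have perd' : periodic_on r d i (i + e + M).
  by apply: periodic_on_extend pere perd => //; rewrite /lo /hi in len *; lia.
(* With [d <= e] the segment is longer than the run, so it passes an end and contains a pair
   breaking period [d]. Either way the repetition itself is contradictory. *)
case: (ltnP i a) => [lt_ia | le_ai].
  case: run_left => [|[]]; first by lia.
  by apply: perd'; rewrite ?modnDr //; rewrite /lo /hi in len *; lia.
case: run_right.
have -> : a + M + d - 1 = a + M - 1 + d by lia.
by apply: perd'; rewrite ?modnDr //; rewrite /lo /hi in len *; lia.
Qed.

End MaximalRun.

(** * Registers, aperiodicity and rotations in terms of indices *)

Import GRing.Theory.
Local Open Scope nat_scope.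

(** One value of [f] serves all occurrences of a word; conversely [f] is read off any occurrence
    that has a successor, with 0 on the other words. *)
Lemma fsr_generableP (s : seq 'Z_2) m :
  reflect (forall i j, i + m < size s -> j + m < size s ->
             (forall x, x < m -> (s`_(i + x))%R = (s`_(j + x))%R) ->
             (s`_(i + m))%R = (s`_(j + m))%R)
          (fsr_generable s m).
Proof.
pose word i := [tuple (s`_(i + x))%R | x < m].
apply: (iffP existsP) => [[f /forallP fP] i j lti ltj eqw | same].
  have lt i' : i' + m < size s -> i' < size s by apply: leq_ltn_trans; rewrite leq_addr.
  have /implyP/(_ lti)/eqP -> := fP (Ordinal (lt _ lti)).
  have /implyP/(_ ltj)/eqP -> := fP (Ordinal (lt _ ltj)).
  by congr (f _); apply: eq_from_tnth => x; rewrite !tnth_mktuple eqw.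
exists [ffun w => if [pick i : 'I_(size s) | (i + m < size s) && (word i == w)]
                  is Some i then (s`_(i + m))%R else 0%R].
apply/forallP => i; apply/implyP => lti; rewrite ffunE.
case: pickP => [j /andP[ltj /eqP eqw] | /(_ i)]; last by rewrite lti eqxx.
apply/eqP/same => // x ltx.
by have := congr1 (fun w => tnth w (Ordinal ltx)) eqw; rewrite !tnth_mktuple.
Qed.

Lemma nlc_eq (s : seq 'Z_2) M :
  fsr_generable s M -> (forall m, m < M -> ~~ fsr_generable s m) -> nlc s = M.
Proof.
move=> genM ngen; rewrite /nlc; case: ex_minnP => m gen min.
apply/eqP; rewrite eqn_leq min //= leqNgt; apply/negP => /ngen.
by rewrite gen.
Qed.

Lemma nth_flatten_nseq (T : Type) (x0 : T) (u : seq T) q i :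
  i < q * size u -> nth x0 (flatten (nseq q u)) i = nth x0 u (i %% size u).
Proof.
elim: q i => [|q IHq] i //; rewrite mulSn /= nth_cat => lti.
case: ltnP => h; first by rewrite modn_small.
rewrite IHq; last by lia.
by rewrite -{2}(subnK h) modnDr.
Qed.

Lemma aperiodicP (s : seq 'Z_2) :
  reflect (forall g, g %| size s -> g < size s ->
             ~ periodic_on (fun i => (s`_i)%R) g 0 (size s))
          (aperiodic s).
Proof.
apply: (iffP forallP) => [ap g gd ltg per | ap [g ltg]].
  have /implyP/(_ gd)/eqP[] := ap (Ordinal ltg).
  have sz : size (take g s) = g by rewrite size_takel // ltnW.
  apply: (@eq_from_nth _ 0%R) => [|i lti].
    by rewrite size_flatten /shape map_nseq sumn_nseq sz mulnC divnK.
  have g0 : 0 < g by apply: (dvdn_gt0 _ gd); lia.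
  rewrite nth_flatten_nseq ?sz ?divnK // nth_take ?ltn_mod //.
  apply: per; rewrite ?modn_mod //=.
  by apply: leq_ltn_trans lti; rewrite leq_mod.
apply/implyP => /= gd; apply/eqP => es; apply: (ap g gd ltg).
have sz : size (take g s) = g by rewrite size_takel // ltnW.
by move=> x y /= hx hy exy; rewrite es !nth_flatten_nseq ?sz ?divnK ?exy.
Qed.

Lemma nth_rotr (T : Type) (x0 : T) (s : seq T) k i :
  k <= size s -> i < size s ->
  nth x0 (rotr k s) i = nth x0 s (if i < k then size s - k + i else i - k).
Proof.
move=> lek lti; rewrite /rotr /rot nth_cat size_drop subKn //.
case: ltnP => h; first by rewrite nth_drop.
by rewrite nth_take //; lia.
Qed.

(** A period dividing the size is cyclic: sending [y] to [(y + k) %% size s] preserves congruence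
    modulo any divisor of the size. *)
Lemma aperiodic_rotr (s : seq 'Z_2) k :
  k <= size s -> aperiodic s -> aperiodic (rotr k s).
Proof.
move=> lek /aperiodicP ap; apply/aperiodicP; rewrite size_rotr => g gd ltg per.
have n0 : 0 < size s by lia.
have e y : y < size s -> (s`_y)%R = ((rotr k s)`_((y + k) %% size s))%R.
  move=> lty; rewrite nth_rotr ?ltn_mod //; case: (ltnP (y + k) (size s)) => h.
    by rewrite modn_small // ltnNge leq_addl addnK.
  have -> : (y + k) %% size s = y + k - size s.
    by rewrite -{1}(subnK h) modnDr modn_small //; lia.
  have -> /= : y + k - size s < k by lia.
  by congr nth; lia.
apply: (ap g gd ltg) => x y /= hx hy exy; rewrite !e //.
apply: per; rewrite ?ltn_mod //.
by rewrite !modn_dvdm // -modnDml exy modnDml.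
Qed.

(** * The run of period [d] in the rotated sequence *)

Section Rotation.

Variables (n c d t : nat) (s : n.-tuple 'Z_2).
Hypotheses (c_ge1 : 1 <= c) (c_ltn : c < n) (c_ge : n./2 <= c).
Hypotheses (d_ge1 : 1 <= d) (d_le : d <= minn (n - c) n./2).
Hypotheses (sB : s \in B n c d) (add_s : seq_add d s = t).

Lemma seq_add_eq i : i < t -> (s`_(n - 1 - i) = s`_(d - 1 - i %% d))%R.
Proof.
move=> lti; move: (lti); rewrite -add_s => /(before_find 0) /negbT.
rewrite nth_iota ?add0n ?negbK => [/eqP // |].
apply: (leq_trans lti); rewrite -add_s -[X in _ <= X](size_iota 0 n).
exact: find_size.
Qed.

Lemma seq_add_neq : t < n -> (s`_(n - 1 - t) <> s`_(d - 1 - t %% d))%R.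
Proof.
move=> ltt; apply/eqP; move: (ltt); rewrite -[X in _ < X](size_iota 0 n) -{1}add_s.
by rewrite -has_find => /(nth_find 0); rewrite -[find _ _]/(seq_add d s) add_s nth_iota.
Qed.

Variable k : nat.
Hypothesis k_le : k <= n - c - d.
(** The first letter of [s] moves to place [k]; period [d] reaches [u] places to its left, limited
    by [t] and by the start of the sequence. *)
Let u := minn k t.
Let r i : 'Z_2 := ((rotr k s)`_i)%R.

Lemma rotrE i : i < n -> r i = (s`_(if (i < k)%N then (n - k + i)%N else (i - k)%N))%R.
Proof. by move=> ltin; rewrite /r nth_rotr size_tuple //; lia. Qed.

Lemma B_period i : i < c.-1 -> (s`_i = s`_(i + d))%R.
Proof.
move=> lti; move: sB; rewrite inE => /and4P[_ _ /forallP per _].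
exact/eqP/(per (Ordinal lti)).
Qed.

Lemma B_break : (s`_(c - 1) <> s`_(c + d - 1))%R.
Proof. by move: sB; rewrite inE => /and4P[_ _ _ /eqP]. Qed.


Lemma rotr_period i : k - u <= i -> i + d < k + c + d - 1 -> r i = r (i + d).
Proof.
move=> le_i lt_i; rewrite !rotrE; try lia.
case: (ltnP i k) => [lt_ik | le_ki]; last first.
  rewrite ifF; last by lia.
  by rewrite B_period; [congr nth | ]; lia.
have -> : n - k + i = n - 1 - (k - 1 - i) by lia.
rewrite seq_add_eq; last by rewrite /u in le_i; lia.
case: (ltnP (i + d) k) => [lt_idk | le_kid].
  have -> : n - k + (i + d) = n - 1 - (k - 1 - (i + d)) by lia.
  rewrite seq_add_eq; last by rewrite /u in le_i; lia.
  have -> : k - 1 - i = k - 1 - (i + d) + d by lia.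
  by rewrite modnDr.
(* Here [i < k <= i + d]: the residue [k - 1 - i] is below [d], and both sides are the same letter
   of [s]. *)
by rewrite modn_small; [congr nth | ]; lia.
Qed.

Lemma rotr_run : periodic_on r d (k - u) (k - u + (c + u) + d - 1).
Proof.
apply: periodic_on_step => i le_i lt_i; apply: rotr_period => //.
by rewrite /u in lt_i *; lia.
Qed.

Lemma rotr_right : r (k - u + (c + u) - 1) <> r (k - u + (c + u) + d - 1).
Proof.
rewrite !rotrE ?ifF; try by rewrite /u; lia.
have -> : k - u + (c + u) - 1 - k = c - 1 by rewrite /u; lia.
have -> : k - u + (c + u) + d - 1 - k = c + d - 1 by rewrite /u; lia.
exact: B_break.
Qed.

Lemma rotr_left : k - u = 0 \/ r (k - u - 1) <> r (k - u - 1 + d).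
Proof.
case: (leqP k t) => [le_kt | lt_tk]; first by left; rewrite /u; lia.
have -> : u = t by rewrite /u; lia.
right; rewrite !rotrE; try lia.
rewrite ifT; last by lia.
have -> : n - k + (k - t - 1) = n - 1 - t by lia.
(* If [d <= t], the place [d] further on is still in the part moved to the front, where the period
   word continues backwards; otherwise it lies in the first word itself. *)
case: (ltnP (k - t - 1 + d) k) => h.
  have -> : n - k + (k - t - 1 + d) = n - 1 - (t - d) by lia.
  rewrite (seq_add_eq (i := t - d)); last by lia.
  rewrite -(modnDr (t - d)) subnK; last by lia.
  by apply: seq_add_neq; lia.
have := seq_add_neq; rewrite modn_small; last by lia.
have -> : k - t - 1 + d - k = d - 1 - t by lia.
by apply; lia.
Qed.

(** The aperiodic first [d] letters of [s] stand at [k]. A free [lo] covers that word and also the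
    one at 0, needed for membership in [B]. *)
Lemma rotr_primitive g lo : k - u <= lo -> lo + d <= k + c + d - 1 ->
  g %| d -> g < d -> ~ periodic_on r g lo (lo + d).
Proof.
move=> lo_ge lo_le.
have rk z : z < d -> (s`_z)%R = r (k + z).
  by move=> ltz; rewrite rotrE ?ifF ?addKn //; lia.
have := sB; rewrite inE => /and4P[_ /aperiodicP ap _ _].
have szd : size (take d s) = d by rewrite size_takel // size_tuple; lia.
rewrite szd in ap.
apply: (@run_primitive _ r d (k - u) (c + u) k) => //; try by rewrite /u; lia.
- exact: rotr_run.
- move=> {}g gd ltg per; apply: (ap g gd ltg) => x y hx hy exy.
  move: hx hy => /= hx hy; rewrite !nth_take // !rk //.
  by apply: per; rewrite ?leq_addr ?ltn_add2l // -modnDmr exy modnDmr.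
Qed.

Lemma nlc_rotr : nlc (rotr k s) = c + u.
Proof.
apply: nlc_eq.
  apply/fsr_generableP.
  have ind i j : i < j -> j + (c + u) < n ->
      (forall x, x < c + u -> r (i + x) = r (j + x)) ->
      r (i + (c + u)) = r (j + (c + u)).
    move=> ltij ltj; rewrite -(subnKC (ltnW ltij)).
    apply: (@run_same_successor _ r n d (k - u) (c + u) k) => //; try by rewrite /u; lia.
    - exact: rotr_run.
    - by move=> g; apply: rotr_primitive; rewrite /u; lia.
    - exact: rotr_right.
    - exact: rotr_left.
  rewrite size_rotr size_tuple => i j lti ltj eqw.
  case: (ltngtP i j) => [ltij | ltji | -> //]; first exact: ind.
  by apply/esym/ind => // x /eqw.
move=> m ltm; apply/negP => /fsr_generableP gen.
(* The two windows of length [m] end just before the two letters of [rotr_right]. *)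
have e x : k - u + (c + u - 1 - m) + d + x = k - u + (c + u - 1 - m) + x + d.
  by rewrite addnAC.
apply: rotr_right.
have -> : k - u + (c + u) - 1 = k - u + (c + u - 1 - m) + m by lia.
have -> : k - u + (c + u) + d - 1 = k - u + (c + u - 1 - m) + d + m by lia.
apply: gen; rewrite ?size_rotr ?size_tuple; try by rewrite /u in ltm *; lia.
move=> x ltx; rewrite -!/(r _) e; apply: rotr_period; rewrite /u in ltm *; lia.
Qed.

End Rotation.

Theorem proposition1 (n c d t : nat) (s : n.-tuple 'Z_2)
    (c_ge1 : 1 <= c) (c_ltn : c < n) (c_ge : n./2 <= c)
    (d_ge1 : 1 <= d) (d_le : d <= minn (n - c) n./2)
    (sB : s \in B n c d) (add_s : seq_add d s = t) :
  (forall k : nat, 1 <= k <= minn t (n - c - d) ->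
     [tuple of rotr k s] \in B n (c + k) d /\ nlc (rotr k s) = c + k) /\
  (forall k : nat, t < k <= n - c - d -> nlc (rotr k s) = c + t).
Proof.
split=> k /andP[k_gt k_le]; last first.
  by rewrite (nlc_rotr c_ge1 c_ltn c_ge d_ge1 d_le sB add_s k_le) (minn_idPr (ltnW k_gt)).
have [le_kt le_k] : k <= t /\ k <= n - c - d by lia.
(* For [k <= t] the run starts at place 0, so its properties are the conditions of [B]. *)
have ku : minn k t = k by lia.
split; last by rewrite (nlc_rotr c_ge1 c_ltn c_ge d_ge1 d_le sB add_s le_k) ku.
have right := rotr_right c_ge1 c_ltn c_ge d_ge1 d_le sB add_s le_k.
rewrite ku subnn !add0n /= in right.
rewrite inE; apply/and4P; split.
- apply: aperiodic_rotr; first by rewrite size_tuple; lia.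
  by have := sB; rewrite inE => /and4P[].
- apply/aperiodicP.
  have -> : size (take d (rotr k s)) = d by rewrite size_takel // size_rotr size_tuple; lia.
  move=> g gd ltg per.
  apply: (rotr_primitive c_ge1 c_ltn c_ge d_ge1 d_le sB add_s le_k (lo := 0) _ _ gd ltg);
    try lia.
  rewrite add0n => x y hx hy exy.
  by have := per x y hx hy exy; move: hx hy => /= hx hy; rewrite !nth_take.
- apply/forallP => i; apply/eqP.
  have lti := ltn_ord i.
  by apply: (rotr_period c_ge1 c_ltn c_ge d_ge1 d_le sB add_s le_k); lia.
- exact/eqP.
Qed.
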